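(* Let $X\in\mathbb{R}^{m\times n}$ have $\mathrm{rank}(X)=n$, and let $k$ be a fixed integer with $0<k<n$. Let $X_k^*\in\mathbb{R}^{m\times k}$ be a column submatrix of $X$ that maximizes $\log\mathrm{vol}(B)$ among all column submatrices $B\in\mathbb{R}^{m\times k}$ of $X$. Then the output matrix $X_k\equiv X_{\mathcal{S}_k}$ of the Businger–Golub QR column selection algorithm applied to $X$ satisfies $$0\le\log\mathrm{vol}(X_k^* )-\log\mathrm{vol}(X_k)\le\left(1-\tfrac1k\right)^k\log\mathrm{vol}\bigl(X_k^*/\sigma_n(X)\bigr),$$ where $(1-\tfrac1k)^k\le\tfrac1e<.37$.
   Context: $\sigma_1(X)\ge\cdots\ge\sigma_n(X)$ are the singular values of $X$. For $\mathcal{S}\subset\{1,\ldots,n\}$, $X_{\mathcal{S}}$ is the submatrix of $X$ consisting of the columns indexed by $\mathcal{S}$. For a matrix $B$ with full column rank, $\mathrm{vol}(B)=\sqrt{\det(B^TB)}$, the product of its singular values. Businger–Golub QR column selection (QR with column pivoting). Input: $X\in\mathbb{R}^{m\times n}$ with columns $x_1,\ldots,x_n$, and an integer $0<k\le\mathrm{rank}(X)$. Set $P_0=0\in\mathbb{R}^{m\times m}$, $\mathcal{S}_0=\emptyset$, $\mathcal{T}_0=\{1,\ldots,n\}$. For $j=1,\ldots,k$: select $t\in\mathcal{T}_{j-1}$ with $\|(I-P_{j-1})x_t\|=\max_{i\in\mathcal{T}_{j-1}}\|(I-P_{j-1})x_i\|$ (Euclidean norm); set $\mathcal{S}_j=\mathcal{S}_{j-1}\cup\{t\}$,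 $\mathcal{T}_j=\mathcal{T}_{j-1}-\{t\}$, $y_j=(I-P_{j-1})x_t$, and $P_j=P_{j-1}+y_jy_j^\dagger$ with $y_j^\dagger=y_j^T/\|y_j\|^2$. Output: the $m\times k$ column submatrix $X_{\mathcal{S}_k}$. *)

(* Defs.v *)
From mathcomp Require Import all_boot all_order all_algebra.
From mathcomp Require Import polyrcf.
From mathcomp Require Import reals.

Set Implicit Arguments.
Unset Strict Implicit.
Unset Printing Implicit Defensive.

Import Order.TTheory GRing.Theory Num.Theory.
Local Open Scope ring_scope.

(* The real eigenvalues of A, each repeated according to its algebraic
   multiplicity, in increasing order; for a symmetric A these are all of its
   n eigenvalues. *)
Definition real_eigenvalues (R : realType) (n : nat) (A : 'M[R]_n) : seq R :=
  flatten [seq nseq (mup x (char_poly A)) x | x <- rootsR (char_poly A)].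

Definition singular_values (R : realType) (m n : nat) (X : 'M[R]_(m, n)) :
    seq R :=
  sort >=%R [seq Num.sqrt x | x <- real_eigenvalues (X^T *m X)].

(* Indexed from 1: sigma_1(X) >= ... >= sigma_n(X). *)
Definition singular_value (R : realType) (m n : nat) (X : 'M[R]_(m, n))
    (i : nat) : R :=
  nth 0 (singular_values X) i.-1.

Definition col_submx (R : realType) (m n : nat) (X : 'M[R]_(m, n))
    (S : {set 'I_n}) : 'M[R]_(m, #|S|) :=
  colsub (fun j : 'I_#|S| => enum_val j) X.

Definition vol (R : realType) (m p : nat) (B : 'M[R]_(m, p)) : R :=
  Num.sqrt (\det (B^T *m B)).

(* The norm `|v| of MathComp-Analysis on matrices is the sup norm, hence this
   separate Euclidean norm. *)
Definition norm2 (R : realType) (m : nat) (v : 'cV[R]_m) : R :=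
  Num.sqrt (\sum_(i < m) v i 0 ^+ 2).

(* y^dagger = y^T / ||y||^2 *)
Definition vpinv (R : realType) (m : nat) (y : 'cV[R]_m) : 'rV[R]_m :=
  (norm2 y ^+ 2)^-1 *: y^T.

(* bg_state X j S T P: after j steps of the Businger-Golub column selection the
   variables (S_j, T_j, P_j) can have the values (S, T, P).  This is a relation
   because ties in the choice of the pivot t are broken arbitrarily. *)
Inductive bg_state (R : realType) (m n : nat) (X : 'M[R]_(m, n)) :
    nat -> {set 'I_n} -> {set 'I_n} -> 'M[R]_m -> Prop :=
| bg_init : bg_state X 0 set0 setT 0
| bg_step (j : nat) (S T : {set 'I_n}) (P : 'M[R]_m) (t : 'I_n)
    (y : 'cV[R]_m) :
    bg_state X j S T P ->
    t \in T ->
    (forall i, i \in T ->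
      norm2 ((1%:M - P) *m col i X) <= norm2 ((1%:M - P) *m col t X)) ->
    y = (1%:M - P) *m col t X ->
    bg_state X j.+1 (t |: S) (T :\ t) (P + y *m vpinv y).

Definition bg_output (R : realType) (m n : nat) (X : 'M[R]_(m, n)) (k : nat)
    (S : {set 'I_n}) : Prop :=
  exists (T : {set 'I_n}) (P : 'M[R]_m), bg_state X k S T P.

(* Main.v *)
Require Import Defs.
From mathcomp Require Import all_boot all_order all_algebra.
From mathcomp Require Import perm polyrcf complex.
From mathcomp Require Import reals sequences exp.
From mathcomp Require Import ring lra.

Set Implicit Arguments.
Unset Strict Implicit.
Unset Printing Implicit Defensive.

Import Order.TTheory GRing.Theory Num.Theory.
Local Open Scope ring_scope.

(** Column pivoting is the greedy algorithm for a monotone submodular set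
    function, so the classical bound for greedy maximization under a
    cardinality constraint applies.

    Let sigma be the smallest singular value of X and put
    g(S) = log vol(X_S / sigma).  If P is the orthogonal projector onto the
    span of the columns in S and t lies outside S, then
    vol(X_(S + t)) = vol(X_S) ||(I - P) x_t||  ([vol_setU1]), so the marginal
    gain is g(S + t) - g(S) = log ||(I - P) x_t|| - log sigma
    ([excess_logvol_setU1]).  Three facts follow.
    - The residual (I - P) x_t equals X c for some c whose t-th entry is 1,
      hence its norm is at least sigma ([residual_ge_singular_value]):
      g is monotone.  This is why the volume is rescaled by sigma.
    - Enlarging S shrinks residuals ([residual_antimono]): g is submodular.
    - The pivot, having the longest residual, is the column with the largest
      marginal gain ([bg_state_gap]).

    For any k columns O, monotonicity and submodularity give
    g(O) <= g(S + O) <= g(S) + k max_t (g(S + t) - g(S)), so each greedy step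
    multiplies the gap g(O) - g(S) by at most 1 - 1/k ([greedy_gap]).  After k
    steps from g(empty) = 0 the gap is at most (1 - 1/k)^k g(O).  For two
    k-subsets the rescaling cancels and the gap is a difference of log volumes.

    The remaining input is that sigma is positive and that
    sigma ||c|| <= ||X c||.  Since singular values are defined through the real
    roots of the characteristic polynomial of X^T X, this rests on the spectral
    theorem, applied over the complex numbers: the n diagonal entries are real,
    they are all the roots, and the least of them bounds the Rayleigh quotient
    from below ([singular_value_last_bound]). *)

(** * Euclidean norm *)

Lemma norm2_ge0 (R : realType) (m : nat) (v : 'cV[R]_m) : 0 <= norm2 v.
Proof. exact: sqrtr_ge0. Qed.

Lemma norm2_sq (R : realType) (m : nat) (v : 'cV[R]_m) :
  norm2 v ^+ 2 = \sum_i v i 0 ^+ 2.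
Proof. by rewrite sqr_sqrtr ?sumr_ge0 // => i _; rewrite sqr_ge0. Qed.

Lemma norm2_sqE (R : realType) (m : nat) (v : 'cV[R]_m) :
  (v^T *m v) 0 0 = norm2 v ^+ 2.
Proof. by rewrite norm2_sq mxE; apply: eq_bigr => i _; rewrite mxE. Qed.

Lemma norm2_eq0 (R : realType) (m : nat) (v : 'cV[R]_m) :
  (norm2 v == 0) = (v == 0).
Proof.
rewrite -sqrf_eq0 norm2_sq psumr_eq0; last by move=> i _; exact: sqr_ge0.
apply/allP/eqP => [v0|-> i _]; last by rewrite mxE expr0n eqxx.
apply/colP => i; rewrite mxE; apply/eqP.
by rewrite -sqrf_eq0; exact: (implyP (v0 i (mem_index_enum i))).
Qed.

Lemma norm2_mulmx (R : realType) (m n : nat) (X : 'M[R]_(m, n))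
    (c : 'cV[R]_n) :
  norm2 (X *m c) ^+ 2 = (c^T *m (X^T *m X) *m c) 0 0.
Proof. by rewrite -norm2_sqE trmx_mul !mulmxA. Qed.

(** * Spectral theory of real symmetric matrices *)

(** A real symmetric matrix is Hermitian over R[i], so it is unitarily
    diagonalizable there, with real diagonal.  A complex U suffices: below, only
    the characteristic polynomial and the quadratic form of A are read off. *)
Lemma symmetric_diagonalization (R : realType) (n : nat) (A : 'M[R]_n) :
  A^T = A ->
  exists (d : 'rV[R]_n) (U : 'M[R[i]]_n),
    U *m map_mx Num.conj U^T = 1%:M /\
    map_mx (real_complex R) A =
      map_mx Num.conj U^T *m diag_mx (map_mx (real_complex R) d) *m U.
Proof.
move=> symA; set AC := map_mx _ A.
have realAC : AC \is a mxOver Num.real.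
  by apply/mxOverP => i j; rewrite mxE; apply/complex_realP; exists (A i j).
have hermAC : AC \is hermsymmx.
  apply: realsym_hermsym => //; apply/is_hermitianmxP.
  by rewrite /= expr0 scale1r map_mx_id // map_trmx symA.
have realD := hermitian_spectral_diag_real hermAC.
exists (map_mx (@complex.Re R) (spectral_diag AC)), (spectralmx AC).
have U_unitary := spectral_unitarymx AC.
split; first exact/unitarymxP.
rewrite -map_mx_comp (_ : map_mx _ (spectral_diag AC) = spectral_diag AC).
  rewrite -invmx_unitary //.
  exact/orthomx_spectralP/hermitian_normalmx.
by apply/rowP => i; rewrite mxE /= RRe_real ?(mxOverP realD).
Qed.

Lemma char_poly_similar (F : fieldType) (n : nat) (U V D : 'M[F]_n) :
  U *m V = 1%:M -> char_poly (V *m D *m U) = char_poly D.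
Proof.
move=> UV1; have VU1 := mulmx1C UV1.
rewrite /char_poly /char_poly_mx.
have -> : 'X%:M - map_mx polyC (V *m D *m U) =
   map_mx polyC V *m ('X%:M - map_mx polyC D) *m map_mx polyC U.
  rewrite mulmxBr mulmxBl !map_mxM; congr (_ - _).
  by rewrite scalar_mxC -mulmxA -map_mxM VU1 map_mx1 mulmx1.
by rewrite !det_mulmx mulrAC -det_mulmx -map_mxM VU1 map_mx1 det1 mul1r.
Qed.

Lemma char_poly_symmetric (R : realType) (n : nat) (A : 'M[R]_n)
    (d : 'rV[R]_n) (U : 'M[R[i]]_n) :
  U *m map_mx Num.conj U^T = 1%:M ->
  map_mx (real_complex R) A =
    map_mx Num.conj U^T *m diag_mx (map_mx (real_complex R) d) *m U ->
  char_poly A = \prod_(x <- [seq d 0 i | i <- enum 'I_n]) ('X - x%:P).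
Proof.
move=> UU defA; apply: (map_poly_inj (real_complex R)).
rewrite map_char_poly defA char_poly_similar //.
rewrite char_poly_trig ?diag_mx_is_trig //.
rewrite rmorph_prod big_map big_enum /=; apply: eq_bigr => i _.
by rewrite rmorphB /= map_polyX map_polyC /= !mxE eqxx.
Qed.

(** In the coordinates u = U c the quadratic form is the sum of d_i |u_i|^2, and
    |u|^2 = |c|^2 because U is unitary. *)
Lemma rayleigh_lower_bound (R : realType) (n : nat) (A : 'M[R]_n)
    (d : 'rV[R]_n) (U : 'M[R[i]]_n) (mu : R) (c : 'cV[R]_n) :
  U *m map_mx Num.conj U^T = 1%:M ->
  map_mx (real_complex R) A =
    map_mx Num.conj U^T *m diag_mx (map_mx (real_complex R) d) *m U ->
  (forall i, mu <= d 0 i) ->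
  mu * norm2 c ^+ 2 <= (c^T *m A *m c) 0 0.
Proof.
move=> UU defA le_mu; have VU1 := mulmx1C UU.
pose cC := map_mx (real_complex R) c; pose u := U *m cC.
have uE : map_mx Num.conj u^T = cC^T *m map_mx Num.conj U^T.
  rewrite trmx_mul map_mxM; congr (_ *m _).
  apply/matrixP => i j; rewrite !mxE.
  by apply: conj_Creal; apply/complex_realP; exists (c j i).
have toC (M : 'M[R]_n) : ((c^T *m M *m c) 0 0)%:C%C =
    (cC^T *m map_mx (real_complex R) M *m cC) 0 0.
  by rewrite /cC map_trmx -!map_mxM [RHS]mxE.
have normE : (norm2 c ^+ 2)%:C%C = \sum_i `|u i 0| ^+ 2.
  rewrite -norm2_sqE -{1}[c^T]mulmx1 toC map_mx1 -VU1 !mulmxA -uE.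
  rewrite -mulmxA -/u mxE.
  by apply: eq_bigr => i _; rewrite normCK !mxE mulrC.
rewrite -lecR toC defA !mulmxA -uE -2!mulmxA -/u mxE rmorphM /= normE mulr_sumr.
apply: ler_sum => i _; move: {uE normE} (u) => w.
have -> : (map_mx Num.conj w^T) 0 i *
    (diag_mx (map_mx (real_complex R) d) *m w) i 0 = (d 0 i)%:C%C * `|w i 0| ^+ 2.
  by rewrite normCK mul_diag_mx !mxE mulrCA [_ * w i 0]mulrC.
by apply: ler_wpM2r; [rewrite exprn_ge0 | rewrite lecR].
Qed.

Lemma count_flatten_nseq (T : eqType) (f : T -> nat) (s : seq T) (x : T) :
  uniq s ->
  count_mem x (flatten [seq nseq (f y) y | y <- s]) = ((x \in s) * f x)%N.
Proof.
elim: s => //= y s IHs /andP[ys us]; rewrite count_cat count_nseq.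
rewrite IHs // in_cons.
rewrite /= eq_sym; case: eqP => [->|_]; rewrite ?(negPf ys) ?mul0n //=.
by rewrite !mul1n addn0.
Qed.

(** Both lists give each x the same count: its multiplicity as a root. *)
Lemma perm_real_eigenvalues (R : realType) (n : nat) (A : 'M[R]_n)
    (s : seq R) :
  char_poly A = \prod_(x <- s) ('X - x%:P) -> perm_eq (real_eigenvalues A) s.
Proof.
move=> charA; apply/allP => x _ /=; apply/eqP.
have p0 : char_poly A != 0 by rewrite monic_neq0 ?char_poly_monic.
rewrite count_flatten_nseq; last first.
  by apply: sorted_uniq (sorted_roots _ _ _); [exact: lt_trans|exact: ltxx].
have := roots_on_rootsR p0 x; rewrite in_itv /= => <-.
rewrite -mu_prod_XsubC -charA.
by case: (boolP (root _ x)) => [_|/mupNroot ->]; rewrite ?mul1n ?muln0.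
Qed.

(** * The smallest singular value *)

(** For an eigenvector v, |X v|^2 = a |v|^2, and X is injective. *)
Lemma gram_eigenvalue_gt0 (R : realType) (m n : nat) (X : 'M[R]_(m, n))
    (a : R) :
  \rank X = n -> root (char_poly (X^T *m X)) a -> 0 < a.
Proof.
move=> rankX; rewrite -eigenvalue_root_char => /eigenvalueP[v vA v0].
have Xv0 : X *m v^T != 0.
  rewrite -trmx_eq0 trmx_mul trmxK mulmx_free_eq0 //.
  by rewrite /row_free mxrank_tr rankX.
have := norm2_mulmx X v^T; rewrite trmxK vA -scalemxAl mxE.
have -> : (v *m v^T) 0 0 = norm2 v^T ^+ 2 by rewrite -norm2_sqE trmxK.
move=> e; have : 0 < norm2 (X *m v^T) ^+ 2.
  by rewrite exprn_gt0 // lt_neqAle eq_sym norm2_eq0 Xv0 norm2_ge0.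
by rewrite e pmulr_lgt0 // exprn_gt0 // lt_neqAle eq_sym norm2_eq0
  trmx_eq0 v0 norm2_ge0.
Qed.

(** The list of singular values is sorted in decreasing order and, the
    characteristic polynomial being split, has length n, so that the entry of
    index n.-1 is a true minimum rather than the default value 0. *)
Lemma singular_value_last (R : realType) (m n : nat) (X : 'M[R]_(m, n))
    (d : 'rV[R]_n) :
  (0 < n)%N ->
  char_poly (X^T *m X) =
    \prod_(x <- [seq d 0 i | i <- enum 'I_n]) ('X - x%:P) ->
  (exists i, singular_value X n = Num.sqrt (d 0 i)) /\
  (forall i, singular_value X n <= Num.sqrt (d 0 i)).
Proof.
move=> n_gt0 /perm_real_eigenvalues/(perm_map Num.sqrt).
rewrite -map_comp; set t := (X in perm_eq _ X) => ev_t.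
have s_t : perm_eq (singular_values X) t.
  by rewrite /singular_values perm_sort.
have size_s : size (singular_values X) = n.
  by rewrite (perm_size s_t) size_map size_enum_ord.
have mem_s x : (x \in singular_values X) = (x \in t) by apply: perm_mem.
rewrite /singular_value; split=> [|i].
  have : nth 0 (singular_values X) n.-1 \in t.
    by rewrite -mem_s mem_nth // size_s prednK.
  by case/mapP => i _ ->; exists i.
have /nthP : Num.sqrt (d 0 i) \in singular_values X.
  by rewrite mem_s; apply/mapP; exists i; rewrite ?mem_enum.
move=> /(_ 0)[j]; rewrite size_s => j_lt <-.
apply: (@sorted_leq_nth _ >=%R) => //.
- by move=> y x z xy yz; apply: le_trans yz xy.
- by move=> x; exact: lexx.
- by apply: sort_sorted => x y; exact: le_total.
- by rewrite inE size_s.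
- by rewrite inE size_s prednK.
- by rewrite -ltnS prednK.
Qed.

Lemma singular_value_last_bound (R : realType) (m n : nat) (X : 'M[R]_(m, n)) :
  (0 < n)%N -> \rank X = n ->
  0 < singular_value X n /\
  (forall c : 'cV_n, singular_value X n * norm2 c <= norm2 (X *m c)).
Proof.
move=> n_gt0 rankX.
have symA : (X^T *m X)^T = X^T *m X by rewrite trmx_mul trmxK.
have [d [U [UU defA]]] := symmetric_diagonalization symA.
have charA := char_poly_symmetric UU defA.
have d_gt0 i : 0 < d 0 i.
  apply: (gram_eigenvalue_gt0 rankX).
  by rewrite charA root_prod_XsubC map_f ?mem_enum.
have [[i sE] s_min] := singular_value_last n_gt0 charA.
have s_gt0 : 0 < singular_value X n by rewrite sE sqrtr_gt0.
split=> // c.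
rewrite -(@ler_pXn2r _ 2) // ?nnegrE ?mulr_ge0 ?norm2_ge0 ?(ltW s_gt0) //.
rewrite exprMn norm2_mulmx.
apply: (rayleigh_lower_bound _ UU defA) => j.
have := s_min j.
rewrite -(@ler_pXn2r _ 2) // ?nnegrE ?sqrtr_ge0 ?(ltW s_gt0) //.
by rewrite [X in _ <= X]sqr_sqrtr // ltW.
Qed.

(** * Orthogonal projectors onto spans of columns *)

(** P is the orthogonal projector onto the span of the columns of X indexed by
    S.  The range condition uses a factor C on all n columns, with zero rows
    outside S, rather than a matrix indexed by the elements of S: the type of C
    then does not change when S grows. *)
Definition is_projector (R : realType) (m n : nat) (X : 'M[R]_(m, n))
    (S : {set 'I_n}) (P : 'M[R]_m) : Prop :=
  [/\ P^T = P,
      forall i, i \in S -> P *m col i X = col i X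
    & exists2 C : 'M[R]_(n, m), P = X *m C
        & forall i, i \notin S -> row i C = 0].

Lemma is_projector0 (R : realType) (m n : nat) (X : 'M[R]_(m, n)) :
  is_projector X set0 0.
Proof.
split=> [|i|]; rewrite ?trmx0 ?inE //.
by exists 0 => [|i _]; rewrite ?mulmx0 ?row0.
Qed.

(** Q fixes the columns in S, and these span the range of P. *)
Lemma projector_absorb (R : realType) (m n : nat) (X : 'M[R]_(m, n))
    (S S' : {set 'I_n}) (P Q : 'M[R]_m) :
  S \subset S' -> is_projector X S P -> is_projector X S' Q -> Q *m P = P.
Proof.
move=> sSS' [_ _ [C defP C0]] [_ Qx _]; rewrite defP mulmxA.
apply/matrixP => a b; rewrite [LHS]mxE [RHS]mxE; apply: eq_bigr => i _.
have [iS|/C0/rowP/(_ b) Cib] := boolP (i \in S); last first.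
  have -> : C i b = 0 by move: Cib; rewrite !mxE.
  by rewrite !mulr0.
have QX : col i (Q *m X) = col i X.
  by rewrite colE -mulmxA -colE Qx // (subsetP sSS').
by have /colP/(_ a) := QX; rewrite ![col _ _ _ _]mxE => ->.
Qed.

Lemma residual_sym (R : realType) (m : nat) (P : 'M[R]_m) :
  P^T = P -> (1%:M - P)^T = 1%:M - P.
Proof. by move=> symP; rewrite raddfB /= trmx1 symP. Qed.

Lemma residual_idem (R : realType) (m n : nat) (X : 'M[R]_(m, n))
    (S : {set 'I_n}) (P : 'M[R]_m) :
  is_projector X S P -> (1%:M - P)^T *m (1%:M - P) = 1%:M - P.
Proof.
move=> projP; have [symP _ _] := projP.
rewrite residual_sym // mulmxBl mul1mx.
by rewrite mulmxBr mulmx1 (projector_absorb (subxx S) projP projP) subrr subr0.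
Qed.

Lemma norm2_residual_le (R : realType) (m n : nat) (X : 'M[R]_(m, n))
    (S : {set 'I_n}) (P : 'M[R]_m) (v : 'cV[R]_m) :
  is_projector X S P -> norm2 ((1%:M - P) *m v) <= norm2 v.
Proof.
move=> projP; have [symP _ _] := projP.
rewrite -(@ler_pXn2r _ 2) ?nnegrE ?norm2_ge0 // norm2_mulmx.
rewrite (residual_idem projP).
have PP : P = P^T *m P by rewrite symP (projector_absorb (subxx S) projP projP).
rewrite {1}PP mulmxBr mulmxBl mulmx1 mxE [X in _ + X <= _]mxE norm2_sqE.
by rewrite -norm2_mulmx gerBl exprn_ge0 // norm2_ge0.
Qed.

(** By [projector_absorb], I - Q = (I - Q)(I - P): the smaller residual is a
    projection of the larger one. *)
Lemma residual_antimono (R : realType) (m n : nat) (X : 'M[R]_(m, n))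
    (S S' : {set 'I_n}) (P Q : 'M[R]_m) (v : 'cV[R]_m) :
  S \subset S' -> is_projector X S P -> is_projector X S' Q ->
  norm2 ((1%:M - Q) *m v) <= norm2 ((1%:M - P) *m v).
Proof.
move=> sSS' projP projQ.
have -> : 1%:M - Q = (1%:M - Q) *m (1%:M - P).
  rewrite mulmxBr mulmx1 mulmxBl mul1mx (projector_absorb sSS' projP projQ).
  by rewrite subrr subr0.
by rewrite -mulmxA (norm2_residual_le _ projQ).
Qed.

Lemma residual_in_range (R : realType) (m n : nat) (X : 'M[R]_(m, n))
    (C : 'M[R]_(n, m)) (t : 'I_n) :
  (1%:M - X *m C) *m col t X = X *m (delta_mx t 0 - C *m col t X).
Proof. by rewrite mulmxBl mul1mx mulmxBr -colE mulmxA. Qed.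

(** The residual is X c with c = e_t - C x_t.  Row t of C vanishes, so that
    c has entry 1 at t and norm at least 1. *)
Lemma residual_ge_singular_value (R : realType) (m n : nat)
    (X : 'M[R]_(m, n)) (S : {set 'I_n}) (P : 'M[R]_m) (t : 'I_n) :
  \rank X = n -> is_projector X S P -> t \notin S ->
  singular_value X n <= norm2 ((1%:M - P) *m col t X).
Proof.
move=> rankX [_ _ [C -> C0]] tS; rewrite residual_in_range.
have n_gt0 : (0 < n)%N by apply: leq_ltn_trans (ltn_ord t).
have [s_gt0 s_le] := singular_value_last_bound n_gt0 rankX.
apply: le_trans (s_le _); rewrite ler_peMr ?(ltW s_gt0) //.
rewrite -(@ler_pXn2r _ 2) ?nnegrE ?norm2_ge0 // expr1n norm2_sq (bigD1 t) //=.
have -> : (delta_mx t 0 - C *m col t X) t 0 = 1.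
  suff: (C *m col t X) t 0 = 0.
    by move=> Cx0; rewrite mxE [X in _ + X]mxE Cx0 mxE !eqxx subr0.
  rewrite mxE big1 // => i _; have /rowP/(_ i) := C0 t tS.
  by rewrite ![_ 0 i]mxE => ->; rewrite mul0r.
by rewrite expr1n lerDl sumr_ge0 // => i _; rewrite sqr_ge0.
Qed.

Lemma residual_gt0 (R : realType) (m n : nat) (X : 'M[R]_(m, n))
    (S : {set 'I_n}) (P : 'M[R]_m) (t : 'I_n) :
  \rank X = n -> is_projector X S P -> t \notin S ->
  0 < norm2 ((1%:M - P) *m col t X).
Proof.
move=> rankX projP tS.
have n_gt0 : (0 < n)%N by apply: leq_ltn_trans (ltn_ord t).
have [s_gt0 _] := singular_value_last_bound n_gt0 rankX.
exact: lt_le_trans s_gt0 (residual_ge_singular_value rankX projP tS).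
Qed.

(** One Gram-Schmidt step.  It also covers a column t already in the span, where
    y = 0 and the update is zero. *)
Lemma projector_step (R : realType) (m n : nat) (X : 'M[R]_(m, n))
    (S : {set 'I_n}) (P : 'M[R]_m) (t : 'I_n) (y : 'cV[R]_m) :
  is_projector X S P -> y = (1%:M - P) *m col t X ->
  is_projector X (t |: S) (P + y *m vpinv y).
Proof.
move=> projP defy; have [symP Px [C defP C0]] := projP.
have symQ := residual_sym symP.
have idQ : (1%:M - P) *m (1%:M - P) = 1%:M - P.
  by rewrite -{1}symQ (residual_idem projP).
have yx : y^T *m col t X = (norm2 y ^+ 2)%:M.
  rewrite [LHS]mx11_scalar; congr _%:M; rewrite -norm2_sqE.
  by rewrite defy trmx_mul symQ -!mulmxA [(1%:M - P) *m (_ *m _)]mulmxA idQ.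
split=> [|i|].
- by rewrite linearD /= symP trmx_mul /vpinv linearZ /= trmxK
    -scalemxAl -scalemxAr.
- rewrite in_setU1 mulmxDl -mulmxA /vpinv -scalemxAl => /predU1P[->|iS].
    have [y0|y0] := eqVneq y 0.
      rewrite y0 mul0mx addr0; apply/eqP; rewrite eq_sym -subr_eq0.
      by rewrite -{1}[col t X]mul1mx -mulmxBl -defy y0.
    rewrite yx scale_scalar_mx mulVf ?sqrf_eq0 ?norm2_eq0 // mulmx1 defy.
    by rewrite mulmxBl mul1mx addrC subrK.
  have -> : y^T *m col i X = 0.
    by rewrite defy trmx_mul symQ -mulmxA mulmxBl mul1mx Px // subrr mulmx0.
  by rewrite scaler0 mulmx0 addr0 Px.
exists (C + (delta_mx t 0 - C *m col t X) *m vpinv y).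
  by rewrite mulmxDr mulmxA -residual_in_range -defP -defy.
move=> i; rewrite in_setU1 negb_or => /andP[it iS].
rewrite linearD /= C0 // add0r row_mul linearB /= row_mul C0 // mul0mx subr0.
by apply/rowP => j; rewrite !mxE big_ord1 !mxE (negPf it) mul0r.
Qed.

(** Submodularity compares residuals for arbitrary sets S, not only for those
    that the algorithm visits. *)
Lemma projector_exists (R : realType) (m n : nat) (X : 'M[R]_(m, n))
    (S : {set 'I_n}) : exists P, is_projector X S P.
Proof.
have [k] := ubnP #|S|; elim: k S => // k IHk S.
have [->|[t tS]] := set_0Vmem S; first by exists 0; exact: is_projector0.
rewrite (cardsD1 t) tS ltnS => /IHk[P projP].
by rewrite -(setD1K tS); eexists; exact: projector_step projP erefl.
Qed.

(** Each update of P is an instance of [projector_step], so the pivot rule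
    compares lengths of residuals. *)
Lemma bg_state_projector (R : realType) (m n : nat) (X : 'M[R]_(m, n))
    (j : nat) (S T : {set 'I_n}) (P : 'M[R]_m) :
  bg_state X j S T P -> [/\ is_projector X S P, T = ~: S & #|S| = j].
Proof.
elim=> [|{j S T P} j S T P t y _ [projP -> cardS] tT _ defy].
  by rewrite setC0 cards0; split=> //; exact: is_projector0.
split; first exact: projector_step.
- by rewrite setCU setIC setDE.
- by rewrite cardsU1 -in_setC tT cardS.
Qed.

(** * Volumes *)

Lemma volZ (R : realType) (m p : nat) (a : R) (B : 'M[R]_(m, p)) :
  0 <= a -> vol (a *: B) = a ^+ p * vol B.
Proof.
move=> a_ge0; rewrite /vol [(a *: B)^T]linearZ /= -scalemxAl -scalemxAr.
rewrite !detZ mulrA -expr2.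
by rewrite sqrtrM ?sqr_ge0 // sqrtr_sqr ger0_norm // exprn_ge0.
Qed.

Lemma vol_mulmx (R : realType) (m p : nat) (B : 'M[R]_(m, p)) (Q : 'M[R]_p) :
  vol (B *m Q) = `|\det Q| * vol B.
Proof.
rewrite /vol trmx_mul mulmxA -[Q^T *m _ *m _]mulmxA !det_mulmx det_tr.
by rewrite mulrAC -expr2 sqrtrM ?sqr_ge0 // sqrtr_sqr.
Qed.

(** Subtracting from the last column its component B c is a unimodular column
    operation; it leaves w, orthogonal to B, and the Gram matrix becomes block
    diagonal. *)
Lemma vol_row_mx (R : realType) (m p : nat) (B : 'M[R]_(m, p))
    (c : 'cV[R]_p) (w : 'cV[R]_m) :
  B^T *m w = 0 -> vol (row_mx B (B *m c + w)) = vol B * norm2 w.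
Proof.
move=> Bw0.
have -> : row_mx B (B *m c + w) = row_mx B w *m block_mx 1%:M c 0 1%:M.
  by rewrite mul_row_block !mulmx1 mulmx0 addr0.
rewrite vol_mulmx det_ublock !det1 mulr1 normr1 mul1r /vol.
have wB0 : w^T *m B = 0 by apply: trmx_inj; rewrite trmx_mul trmxK Bw0 trmx0.
rewrite tr_row_mx mul_col_row wB0 det_ublock det_mx11 norm2_sqE mulrC.
by rewrite sqrtrM ?sqr_ge0 // sqrtr_sqr ger0_norm ?norm2_ge0 // mulrC.
Qed.

(** The two listings differ by a permutation of the columns.  The index types are
    kept distinct because the widths of X_(S + t) and of X_S with one column
    appended are equal only propositionally. *)
Lemma vol_colsub_image (R : realType) (m n p q : nat) (X : 'M[R]_(m, n))
    (f : 'I_p -> 'I_n) (g : 'I_q -> 'I_n) :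
  injective f -> injective g -> codom f =i codom g ->
  vol (colsub f X) = vol (colsub g X).
Proof.
move=> f_inj g_inj fg.
have pq : p = q.
  by rewrite -(card_ord p) -(card_ord q) -(card_codom f_inj) -(card_codom g_inj);
    apply: eq_card.
case: q / pq g g_inj fg => g g_inj fg.
have gf i : g i \in codom f by rewrite fg codom_f.
have s_inj : injective (fun i => iinv (gf i)).
  by move=> i j /(congr1 f); rewrite !f_iinv => /g_inj.
have -> : colsub g X = col_perm (perm s_inj) (colsub f X).
  by apply/matrixP => i j; rewrite !mxE permE f_iinv.
by rewrite col_permE vol_mulmx det_perm normrX normrN1 expr1n mul1r.
Qed.

(** Base times height: x_t = P x_t + (I - P) x_t, where P x_t is a combination of
    the columns in S and the residual is orthogonal to them. *)
Lemma vol_setU1 (R : realType) (m n : nat) (X : 'M[R]_(m, n))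
    (S : {set 'I_n}) (P : 'M[R]_m) (t : 'I_n) :
  is_projector X S P -> t \notin S ->
  vol (col_submx X (t |: S)) =
    vol (col_submx X S) * norm2 ((1%:M - P) *m col t X).
Proof.
move=> projP tS; have [symP Px [C defP C0]] := projP.
(* The columns of X_S followed by column t, as one selection of columns of X;
   it has the same image as the enumeration of t |: S. *)
pose h (j : 'I_(#|S| + 1)) : 'I_n := 
  match split j with inl i => enum_val i | inr _ => t end.
have hX : colsub h X = row_mx (col_submx X S) (col t X).
  by apply/matrixP => i j; rewrite !mxE /h; case: split => k; rewrite !mxE.
have h_inj : injective h.
  move=> i j; rewrite /h -{2}(splitK i) -{2}(splitK j).
  case: (split i) (split j) => [a|a] [b|b] // => [/enum_val_inj->|ab|ab|_] //.
  - by rewrite -ab enum_valP in tS.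
  - by rewrite ab enum_valP in tS.
  - by rewrite !ord1.
rewrite /col_submx (@vol_colsub_image _ _ _ _ _ _ _ h) //; first last.
- move=> i; apply/codomP/codomP => [[j ->]|[j ->]].
    have := enum_valP j; rewrite in_setU1 => /predU1P[->|jS].
      by exists (rshift _ 0); rewrite /h (unsplitK (inr _)).
    by exists (lshift _ (enum_rank_in jS (enum_val j)));
      rewrite /h (unsplitK (inl _)) enum_rankK_in.
  have hj : h j \in t |: S.
    by rewrite /h in_setU1; case: split => k; rewrite ?enum_valP ?orbT ?eqxx.
  by exists (enum_rank_in hj (h j)); rewrite enum_rankK_in.
- exact: enum_val_inj.
pose CS := rowsub (fun j : 'I_#|S| => enum_val j) C.
have defP_S : P = col_submx X S *m CS.
  rewrite defP; apply/matrixP => a b; rewrite [LHS]mxE [RHS]mxE.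
  rewrite [LHS](bigID (mem S)) /= [X in _ + X = _]big1 => [|i iS].
    by rewrite addr0 [LHS]big_enum_val; apply: eq_bigr => j _; rewrite !mxE.
  by have /rowP/(_ b) := C0 i iS; rewrite ![_ 0 b]mxE => ->; rewrite mulr0.
have xE : col t X = col_submx X S *m (CS *m col t X) + (1%:M - P) *m col t X.
  by rewrite mulmxA -defP_S mulmxBl mul1mx addrC subrK.
rewrite hX [X in row_mx _ X]xE vol_row_mx //.
apply: trmx_inj; rewrite trmx_mul trmxK trmx0 trmx_mul residual_sym //.
rewrite -mulmxA (_ : (1%:M - P) *m _ = 0) ?mulmx0 //.
apply/matrixP => a b; have := Px (enum_val b) (enum_valP b).
move/colP/(_ a); rewrite mulmxBl mul1mx !mxE => Pxb.
apply/eqP; rewrite subr_eq0 eq_sym -Pxb; apply/eqP.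
by apply: eq_bigr => i _; rewrite !mxE.
Qed.

(** The volume is a product of residual lengths.  Positivity is what makes
    logarithms of volumes additive. *)
Lemma vol_col_submx_gt0 (R : realType) (m n : nat) (X : 'M[R]_(m, n))
    (S : {set 'I_n}) :
  \rank X = n -> 0 < vol (col_submx X S).
Proof.
move=> rankX; have [k] := ubnP #|S|; elim: k S => // k IHk S.
move=> ltSk; have [->|[t tS]] := set_0Vmem S.
  rewrite /vol; move: (col_submx X set0); rewrite cards0 => B.
  by rewrite det_mx00 sqrtr1 ltr01.
have /IHk vol_gt0 : (#|S :\ t| < k)%N by move: ltSk; rewrite (cardsD1 t S) tS.
rewrite -(setD1K tS).
have [P projP] := projector_exists X (S :\ t).
have tN : t \notin S :\ t by rewrite setD11.
by rewrite (vol_setU1 projP tN) mulr_gt0 // (residual_gt0 rankX projP tN).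
Qed.

(** * Greedy maximization of submodular functions *)

Definition setU1_monotone (R : realType) (T : finType) (f : {set T} -> R) :=
  forall (A : {set T}) t, t \notin A -> f A <= f (t |: A).

Definition submodular (R : realType) (T : finType) (f : {set T} -> R) :=
  forall (A B : {set T}) t, A \subset B -> t \notin B ->
    f (t |: B) - f B <= f (t |: A) - f A.

(** Add the elements of D one at a time; by submodularity each contributes at
    most its marginal gain over A. *)
Lemma submodular_marginal_sum (R : realType) (T : finType)
    (f : {set T} -> R) (A D : {set T}) :
  submodular f -> [disjoint A & D] ->
  f (A :|: D) - f A <= \sum_(t in D) (f (t |: A) - f A).
Proof.
move=> sub_f; have [k] := ubnP #|D|; elim: k D => // k IHk D.
have [->|[t tD]] := set_0Vmem D; first by rewrite setU0 big_set0 subrr.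
rewrite (cardsD1 t) tD ltnS => ltDk AD.
have AD' : [disjoint A & D :\ t] by apply: disjointWr AD; exact: subD1set.
have tA : t \notin A by rewrite (disjointFl AD).
rewrite (big_setD1 t tD) /= -{1}(setD1K tD) setUCA.
have tAD : t \notin A :|: D :\ t by rewrite in_setU setD11 orbF.
have := sub_f _ _ t (subsetUl A (D :\ t)) tAD; have := IHk _ ltDk AD'.
lra.
Qed.

Lemma setU1_monotone_disjointU (R : realType) (T : finType)
    (f : {set T} -> R) (A D : {set T}) :
  setU1_monotone f -> [disjoint A & D] -> f A <= f (A :|: D).
Proof.
move=> mono_f; have [k] := ubnP #|D|; elim: k D => // k IHk D.
have [->|[t tD]] := set_0Vmem D; first by rewrite setU0.
rewrite (cardsD1 t) tD ltnS => ltDk AD.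
have AD' : [disjoint A & D :\ t] by apply: disjointWr AD; exact: subD1set.
have tA : t \notin A by rewrite (disjointFl AD).
rewrite -{1}(setD1K tD) setUCA (le_trans (IHk _ ltDk AD')) // mono_f //.
by rewrite in_setU setD11 orbF.
Qed.

(** One greedy step.  The largest marginal gain is at least the average of those
    over O, and these together cover the gap f O - f S. *)
Lemma greedy_gap (R : realType) (T : finType) (f : {set T} -> R)
    (O S : {set T}) (t : T) (k : nat) :
  setU1_monotone f -> submodular f -> (0 < k)%N -> (#|O| <= k)%N ->
  t \notin S -> (forall i, i \notin S -> f (i |: S) <= f (t |: S)) ->
  f O - f (t |: S) <= (1 - k%:R^-1) * (f O - f S).
Proof.
move=> mono_f sub_f k_gt0 leOk tS greedy.
have disj (A B : {set T}) : [disjoint A & B :\: A].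
  by rewrite -setI_eq0 setIDA setDE -setIA [B :&: _]setIC setIA setICr set0I.
have le1 : f O <= f (S :|: O :\: S).
  have -> : S :|: O :\: S = O :|: S :\: O.
    by apply/setP => i; rewrite !inE; case: (i \in S); case: (i \in O).
  exact: setU1_monotone_disjointU.
have le2 := submodular_marginal_sum sub_f (disj S O).
have le3 : \sum_(i in O :\: S) (f (i |: S) - f S) <= k%:R * (f (t |: S) - f S).
  apply: (@le_trans _ _ (\sum_(i in O :\: S) (f (t |: S) - f S))).
    by apply: ler_sum => i; rewrite inE => /andP[iS _]; rewrite lerB // greedy.
  rewrite sumr_const -[leLHS]mulr_natl ler_wpM2r ?subr_ge0 ?mono_f // ler_nat.
  by rewrite (leq_trans _ leOk) // subset_leq_card // subsetDl.
(* The conclusion is a rearrangement of this inequality. *)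
have : k%:R^-1 * (f O - f S) <= f (t |: S) - f S.
  by rewrite ler_pdivrMl ?ltr0n //; lra.
lra.
Qed.

(** * The rescaled log volume *)

(** Dividing by the smallest singular value makes every marginal gain
    nonnegative.  It changes the log volumes of all sets of a given size by the
    same constant. *)
Definition excess_logvol (R : realType) (m n : nat) (X : 'M[R]_(m, n))
    (S : {set 'I_n}) : R :=
  ln (vol ((singular_value X n)^-1 *: col_submx X S)).

Lemma excess_logvol0 (R : realType) (m n : nat) (X : 'M[R]_(m, n)) :
  excess_logvol X set0 = 0.
Proof.
rewrite /excess_logvol /vol; move: (col_submx X set0); rewrite cards0 => B.
by rewrite det_mx00 sqrtr1 ln1.
Qed.

Lemma excess_logvolE (R : realType) (m n : nat) (X : 'M[R]_(m, n))
    (S : {set 'I_n}) :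
  (0 < n)%N -> \rank X = n ->
  excess_logvol X S =
    ln (vol (col_submx X S)) - ln (singular_value X n) *+ #|S|.
Proof.
move=> n_gt0 rankX; have [s_gt0 _] := singular_value_last_bound n_gt0 rankX.
have v_gt0 := vol_col_submx_gt0 S rankX.
rewrite /excess_logvol volZ ?invr_ge0 ?(ltW s_gt0) //.
rewrite lnM ?posrE ?exprn_gt0 ?invr_gt0 // lnXn ?invr_gt0 // lnV ?posrE //.
by rewrite addrC mulNrn.
Qed.

Lemma excess_logvol_setU1 (R : realType) (m n : nat) (X : 'M[R]_(m, n))
    (S : {set 'I_n}) (P : 'M[R]_m) (t : 'I_n) :
  \rank X = n -> is_projector X S P -> t \notin S ->
  excess_logvol X (t |: S) - excess_logvol X S =
    ln (norm2 ((1%:M - P) *m col t X)) - ln (singular_value X n).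
Proof.
move=> rankX projP tS.
have n_gt0 : (0 < n)%N by apply: leq_ltn_trans (ltn_ord t).
have r_gt0 := residual_gt0 rankX projP tS.
rewrite !excess_logvolE // (vol_setU1 projP tS) cardsU1 tS mulrS.
rewrite lnM ?posrE ?vol_col_submx_gt0 //; ring.
Qed.

Lemma excess_logvol_monotone (R : realType) (m n : nat) (X : 'M[R]_(m, n)) :
  \rank X = n -> setU1_monotone (excess_logvol X).
Proof.
move=> rankX S t tS; have [P projP] := projector_exists X S.
have n_gt0 : (0 < n)%N by apply: leq_ltn_trans (ltn_ord t).
have [s_gt0 _] := singular_value_last_bound n_gt0 rankX.
rewrite -subr_ge0 (excess_logvol_setU1 rankX projP tS) subr_ge0.
have s_le := residual_ge_singular_value rankX projP tS.
by rewrite ler_ln ?posrE // (lt_le_trans s_gt0).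
Qed.

Lemma excess_logvol_submodular (R : realType) (m n : nat) (X : 'M[R]_(m, n)) :
  \rank X = n -> submodular (excess_logvol X).
Proof.
move=> rankX S S' t sSS' tS'.
have [P projP] := projector_exists X S; have [Q projQ] := projector_exists X S'.
have tS : t \notin S by apply: contra tS'; exact: subsetP.
rewrite (excess_logvol_setU1 rankX projP tS).
rewrite (excess_logvol_setU1 rankX projQ tS').
have r_gt0 := residual_gt0 rankX projP tS.
have r'_gt0 := residual_gt0 rankX projQ tS'.
by rewrite lerD2r ler_ln ?posrE // (residual_antimono _ sSS' projP projQ).
Qed.

(** The longest residual gives the largest marginal gain, so each pivot is a
    greedy choice and [greedy_gap] applies at every step. *)
Lemma bg_state_gap (R : realType) (m n : nat) (X : 'M[R]_(m, n))
    (O : {set 'I_n}) (k j : nat) (S T : {set 'I_n}) (P : 'M[R]_m) :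
  \rank X = n -> (0 < k)%N -> (#|O| <= k)%N -> bg_state X j S T P ->
  excess_logvol X O - excess_logvol X S
    <= (1 - k%:R^-1) ^+ j * (excess_logvol X O - excess_logvol X set0).
Proof.
move=> rankX k_gt0 leOk.
elim=> [|{j S T P} j S T P t y st IH tT pivot _]; first by rewrite mul1r.
have [projP defT _] := bg_state_projector st.
have outT i : (i \in T) = (i \notin S) by rewrite defT in_setC.
have tS : t \notin S by rewrite -outT.
have r_gt0 i : i \notin S -> 0 < norm2 ((1%:M - P) *m col i X).
  exact: residual_gt0.
have greedy i : i \notin S ->
    excess_logvol X (i |: S) <= excess_logvol X (t |: S).
  move=> iS; rewrite -(lerD2r (- excess_logvol X S)).
  rewrite !(excess_logvol_setU1 rankX projP) // lerD2r.
  by rewrite ler_ln ?posrE ?r_gt0 // pivot ?outT.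
apply: le_trans (greedy_gap (excess_logvol_monotone rankX)
  (excess_logvol_submodular rankX) k_gt0 leOk tS greedy) _.
rewrite exprS -mulrA ler_wpM2l // subr_ge0 invf_le1 ?ltr0n // ler1n //.
Qed.

(** * Numerical bounds *)

(** The k-th power of 1 - 1/k <= exp(-1/k). *)
Lemma expr_1B_le_expRV (R : realType) (k : nat) :
  (0 < k)%N -> (1 - k%:R^-1) ^+ k <= (expR 1)^-1 :> R.
Proof.
move=> k_gt0; have k_gt0' : 0 < k%:R :> R by rewrite ltr0n.
rewrite -expRN -[X in expR (- X)](mulVf (lt0r_neq0 k_gt0')) -mulNr expRM_natr.
apply: lerXn2r; rewrite ?nnegrE ?expR_ge0 ?subr_ge0 ?invf_le1 ?ler1n //.
exact: expR_ge1Dx.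
Qed.

(** The partial sum 1 + 1 + 1/2 + 1/6 + 1/24 = 65/24 already exceeds 100/37. *)
Lemma expR1V_lt (R : realType) : (expR 1)^-1 < 37 / 100 :> R.
Proof.
have e_ge : 65 / 24 <= expR 1 :> R.
  have -> : 65 / 24 = series (exp_coeff 1) 5 :> R.
    rewrite /series /= !big_nat_recr //= big_geq //.
    by rewrite /exp_coeff /= !expr1n !factS fact0 /=; field.
  apply: nondecreasing_cvgn_le; last exact: is_cvg_series_exp_coeff.
  by apply: nondecreasing_series => i _ _; apply: exp_coeff_ge0; rewrite ler01.
have e_gt0 : 0 < expR 1 :> R by exact: expR_gt0.
by rewrite invf_plt ?posrE //; lra.
Qed.

(** * The approximation guarantee *)

Theorem corollary4p2 (R : realType) (m n k : nat) (X : 'M[R]_(m, n))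
    (rankX : \rank X = n) (k_gt0 : (0 < k)%N) (k_ltn : (k < n)%N)
    (Sopt : {set 'I_n}) (card_Sopt : #|Sopt| = k)
    (max_Sopt : forall S : {set 'I_n}, #|S| = k ->
       ln (vol (col_submx X S)) <= ln (vol (col_submx X Sopt)))
    (Sk : {set 'I_n}) (output_Sk : bg_output X k Sk) :
  [/\ 0 <= ln (vol (col_submx X Sopt)) - ln (vol (col_submx X Sk)),
      ln (vol (col_submx X Sopt)) - ln (vol (col_submx X Sk))
        <= (1 - k%:R^-1) ^+ k
           * ln (vol ((singular_value X n)^-1 *: col_submx X Sopt)),
      (1 - k%:R^-1) ^+ k <= (expR 1)^-1 :> R
    & (expR 1)^-1 < 37 / 100 :> R].
Proof.
have [T [P st]] := output_Sk; have [_ _ card_Sk] := bg_state_projector st.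
split; [ | | exact: expr_1B_le_expRV | exact: expR1V_lt].
  by rewrite subr_ge0 max_Sopt.
have n_gt0 := ltn_trans k_gt0 k_ltn.
have := bg_state_gap rankX k_gt0 (eq_leq card_Sopt) st.
rewrite excess_logvol0 subr0 -/(excess_logvol X Sopt).
rewrite {1}(excess_logvolE Sopt) // (excess_logvolE Sk) //.
have -> : ln (singular_value X n) *+ #|Sopt| = ln (singular_value X n) *+ #|Sk|.
  by rewrite card_Sopt card_Sk.
by rewrite opprB addrA subrK.
Qed.
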